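(* For every superlinear function $g:\mathbb{R}\to\mathbb{R}$ there is a class $\mathcal{C}_g$ of distributions such that: (i) $\mathcal{C}_g$ is realizably PAC learnable with sample complexity $m^{\mathrm{re}}_{\mathcal{C}_g}(\epsilon,\delta)\le \log(1/\delta)\, g(1/\epsilon)$; (ii) for every $\alpha\ge 1$, $\mathcal{C}_g$ is not adaptively additively $\alpha$-robustly learnable; moreover, for every $\alpha\ge1$ there is an adaptive additive adversary $V_{\mathrm{add}}$ that is a universal $\alpha$-adversary for $\mathcal{C}_g$; (iii) for every $\alpha\ge 1$, $\mathcal{C}_g$ is not adaptively subtractively $\alpha$-robustly learnable; moreover, for every $\alpha\ge1$ there is an adaptive subtractive adversary $V_{\mathrm{sub}}$ that is a universal $\alpha$-adversary for $\mathcal{C}_g$.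
   Context: ''Superlinear'' means $g(x)/x\to\infty$. The class used is: let $\{B_i\}_{i\in\mathbb{N}}$ enumerate all finite subsets of $\mathbb{N}$; for $i,j,k\in\mathbb{N}$ let $p_{i,j,k}=(1-\frac1j)\delta_{(0,0)}+(\frac1j-\frac1k)U_{B_i\times\{2j+1\}}+\frac1k\delta_{(i,2j+2)}$ on $\mathbb{N}\times\mathbb{N}$ ($U_A$ uniform on $A$, $\delta_x$ point mass), and $\mathcal{C}_g=\{p_{i,j,g(j)}:i,j\in\mathbb{N}\}$. Samples are multisets (order-free, multiplicities counted); $\mathcal{X}^m$ = multisets of size $m$ over domain $\mathcal{X}$, $\mathcal{X}^*=\bigcup_m\mathcal{X}^m$. Total variation $d_{\mathrm{TV}}(p,q)=\sup_B|p(B)-q(B)|$. Realizable PAC learnability: there is a learner $A:\mathcal{X}^*\to\Delta(\mathcal{X})$ and $m^{\mathrm{re}}_{\mathcal{C}}(\epsilon,\delta)$ such that for all $p\in\mathcal{C}$, $\epsilon,\delta\in(0,1)$, $m\ge m^{\mathrm{re}}_{\mathcal C}(\epsilon,\delta)$, with probability $\ge1-\delta$ over $S\sim p^m$, $d_{\mathrm{TV}}(A(S),p)\le\epsilon$. An adaptive adversary is a (possibly randomized) map $V:\mathcal{X}^*\to\mathcal{X}^*$; it is additive if $S\subset V(S)$ for all $S$, subtractive if $V(S)\subset S$ for all $S$. Budgets: $\mathrm{budget}^{\mathrm{add}}(V,m)=\sup_{S\in\mathcal{X}^m}\frac{|V(S)|-|S|}{m}$, $\mathrm{budget}^{\mathrm{sub}}(V,m)=\sup_{S\in\mathcal{X}^m}\frac{|S|-|V(S)|}{m}$.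 Standing assumption: all adversaries have fixed constant budgets, i.e. $|V(S_1)|=|V(S_2)|$ whenever $|S_1|=|S_2|$, and there is a constant $\eta=\mathrm{budget}(V)$ with $\eta m-1<m\,\mathrm{budget}(V,m)\le\eta m$ for all $m$. For $\alpha\ge1$ and a set $\mathcal V$ of adversaries, $\mathcal{C}$ is adaptively $\alpha$-robustly learnable w.r.t. $\mathcal V$ if there are a learner $A$ and $m(\epsilon,\delta)$ such that for all $p\in\mathcal{C}$, $V\in\mathcal V$, $\epsilon,\delta\in(0,1)$, $m\ge m(\epsilon,\delta)$, with probability $\ge1-\delta$ over $S\sim p^m$ (and the adversary's randomness), $d_{\mathrm{TV}}(A(V(S)),p)\le\alpha\,\mathrm{budget}(V)+\epsilon$. ''Adaptively additively (resp. subtractively) $\alpha$-robustly learnable'' means w.r.t. the class of all adaptive additive (resp. subtractive) adversaries. $V$ is a universal $\alpha$-adversary for $\mathcal C$ if $\mathcal C$ is not adaptively $\alpha$-robustly learnable w.r.t. $\{V\}$. *)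

(* Defs.v *)
From HB Require Import structures.
From mathcomp Require Import all_boot all_order all_algebra.
From mathcomp Require Import all_classical all_reals.
From mathcomp Require Import topology normedtype sequences esum exp.
From mathcomp Require Import finmap.
From mathcomp Require multiset.

Set Implicit Arguments.
Unset Strict Implicit.
Unset Printing Implicit Defensive.

Import Order.TTheory GRing.Theory Num.Theory.
Local Open Scope classical_set_scope.
Local Open Scope ring_scope.

Definition X := (nat * nat)%type.

Definition mset := multiset.multiset X.
Definition msize (S : mset) : nat := size (multiset.enum_mset S).
Definition msub (S T : mset) : Prop := multiset.msubset S T.
Definition mset_of_seq (s : seq X) : mset := multiset.seq_mset s.

Section Defs.
Variable R : realType.

Definition is_distr (T : choiceType) (p : T -> R) : Prop :=
  (forall x, 0 <= p x) /\ (\esum_(x in [set: T]) (p x)%:E = 1)%E.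

Definition prob (T : choiceType) (p : T -> R) (B : set T) : R :=
  fine (\esum_(x in B) (p x)%:E).

Definition dTV (p q : X -> R) : R :=
  sup [set `|prob p B - prob q B| | B in [set: set X]].

(* E_{S ~ p^m} [f S]  (f nonnegative, extended-real valued):
   S is the multiset of m i.i.d. draws from p. *)
Definition sample_expect (p : X -> R) (m : nat) (f : mset -> \bar R) : \bar R :=
  (\esum_(t in [set: m.-tuple X])
     (\prod_(i < m) p (tnth t i))%:E * f (mset_of_seq t))%E.

Definition ind (P : Prop) : \bar R := (if asbool P then 1 else 0)%E.

Definition learner := mset -> (X -> R).
Definition is_learner (A : learner) : Prop := forall S, is_distr (A S).

Definition adversary := mset -> (mset -> R).
Definition is_adversary (V : adversary) : Prop := forall S, is_distr (V S).

Definition outputs (V : adversary) (S S' : mset) : Prop := 0 < V S S'.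

Definition additive (V : adversary) : Prop :=
  forall S S', outputs V S S' -> msub S S'.
Definition subtractive (V : adversary) : Prop :=
  forall S S', outputs V S S' -> msub S' S.

Definition budget_add_m (V : adversary) (m : nat) : R :=
  sup [set r | exists S S', msize S = m /\ outputs V S S' /\
         r = ((msize S')%:R - (msize S)%:R) / m%:R].
Definition budget_sub_m (V : adversary) (m : nat) : R :=
  sup [set r | exists S S', msize S = m /\ outputs V S S' /\
         r = ((msize S)%:R - (msize S')%:R) / m%:R].

Definition fixed_size (V : adversary) : Prop :=
  forall S1 S2 T1 T2, msize S1 = msize S2 ->
    outputs V S1 T1 -> outputs V S2 T2 -> msize T1 = msize T2.

Definition has_budget (bm : adversary -> nat -> R) (V : adversary) (eta : R) : Prop :=
  fixed_size V /\
  forall m : nat, (0 < m)%N ->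
    eta * m%:R - 1 < m%:R * bm V m /\ m%:R * bm V m <= eta * m%:R.

Definition has_budget_add := has_budget budget_add_m.
Definition has_budget_sub := has_budget budget_sub_m.

(* the classes of all adaptive additive / subtractive adversaries
   (with fixed constant budgets, the standing assumption) *)
Definition additive_advs : set adversary :=
  [set V | is_adversary V /\ additive V /\ exists eta, has_budget_add V eta].
Definition subtractive_advs : set adversary :=
  [set V | is_adversary V /\ subtractive V /\ exists eta, has_budget_sub V eta].

Definition pac_learnable_with (C : set (X -> R)) (mb : R -> R -> R) : Prop :=
  exists A : learner, is_learner A /\
    forall p, C p -> forall eps delta : R, 0 < eps < 1 -> 0 < delta < 1 ->
    forall m : nat, mb eps delta <= m%:R ->
      (sample_expect p m (fun S => ind (dTV (A S) p <= eps)%R)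
        >= (1 - delta)%:E)%E.

Definition robust_learnable (C : set (X -> R)) (Vs : set adversary)
    (bud : adversary -> R -> Prop) (alpha : R) : Prop :=
  exists (A : learner) (mf : R -> R -> nat), is_learner A /\
    forall p, C p -> forall V, Vs V -> forall eta, bud V eta ->
    forall eps delta : R, 0 < eps < 1 -> 0 < delta < 1 ->
    forall m : nat, (mf eps delta <= m)%N ->
      (sample_expect p m (fun S =>
         \esum_(S' in [set: mset]) (V S S')%:E
            * ind (dTV (A S') p <= alpha * eta + eps)%R)
        >= (1 - delta)%:E)%E.

Definition add_robust_learnable C alpha :=
  robust_learnable C additive_advs has_budget_add alpha.
Definition sub_robust_learnable C alpha :=
  robust_learnable C subtractive_advs has_budget_sub alpha.

Definition universal_add_adversary (C : set (X -> R)) (V : adversary) alpha :=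
  ~ robust_learnable C [set V] has_budget_add alpha.
Definition universal_sub_adversary (C : set (X -> R)) (V : adversary) alpha :=
  ~ robust_learnable C [set V] has_budget_sub alpha.

Definition superlinear (g : R -> R) : Prop :=
  forall M : R, exists x0 : R, forall x, x0 <= x -> M <= g x / x.

End Defs.

(* Main.v *)
(* A distribution of the class puts most of its mass at the origin, mass about
   [a n] uniformly on the graph of a bit string [s] on [0..N], and mass
   [rate n = a n / (n + 2)] on a hint that encodes [(n, N, s)].  Waiting for the
   hint takes [ln (1/delta) / rate n] samples, and superlinearity allows [a n] to
   be so small that this is at most [ln (1/delta) * g (1/eps)] for [eps < a n];
   for larger [eps] the point mass at the origin is accurate enough.

   By Markov's inequality a budget [2 * rate n] exceeds, with probability at least
   1/2, the fraction of hints in the sample.  A subtractive adversary then removes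
   all hints.  An additive one adds equally many hints for the string obtained
   from [s] by flipping every bit that was not observed.  Either way the corrupted
   samples for the two strings coincide.  When [N >= 2m] the two distributions are
   at distance at least [a n / 4], which exceeds twice [alpha * 2 * rate n] as
   soon as [n] is large compared with [alpha].  Since flipping is an involution, averaging
   over [s] gives a string on which the learner fails. *)

Require Import Defs.
From HB Require Import structures.
From mathcomp Require Import all_boot all_order all_algebra.
From mathcomp Require Import all_classical all_reals.
From mathcomp Require Import topology normedtype sequences esum exp.
From mathcomp Require Import ring lra.
From mathcomp Require Import finmap.
From mathcomp Require multiset.

Set Implicit Arguments.
Unset Strict Implicit.
Unset Printing Implicit Defensive.

Import Order.TTheory GRing.Theory Num.Theory.
Local Open Scope classical_set_scope.
Local Open Scope ring_scope.

(** * Pushforwards of finitely supported weights *)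

Section Pushforward.
Variables (R : realType) (O : finType) (T : choiceType).
Variables (w : O -> R) (h : O -> T).

Definition push (x : T) : R := \sum_o (if x == h o then w o else 0).

Hypothesis w_ge0 : forall o, 0 <= w o.

Lemma push_ge0 x : 0 <= push x.
Proof. by apply: sumr_ge0 => o _; case: ifP. Qed.

(** Each outcome [o] contributes a function supported on the single point [h o], so exchanging the
    sums leaves one term per outcome. This makes the sums over infinite spaces below finite. *)
Lemma esum_push (G : T -> \bar R) : (forall x, 0 <= G x)%E ->
  (\esum_(x in [set: T]) (push x)%:E * G x = \sum_o (w o)%:E * G (h o))%E.
Proof.
move=> G0.
transitivity (\esum_(x in [set: T])
    \sum_o (if x \in [set h o] then (w o)%:E * G x else 0))%E.
  apply: eq_esum => x _; rewrite /push -sumEFin ge0_sume_distrl; last first.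
    by move=> o _; case: ifP => _; rewrite lee_fin.
  apply: eq_bigr => o _; rewrite in_set1; case: ifP => _ //.
  by rewrite mul0e.
rewrite esum_sum; last first.
  by move=> x o _ _; case: ifP => _ //; rewrite mule_ge0 ?lee_fin.
apply: eq_bigr => o _; rewrite -esum_mkcond esum_set1//.
by rewrite mule_ge0 ?lee_fin.
Qed.

Lemma prob_push (B : set T) :
  prob push B = \sum_o (if h o \in B then w o else 0).
Proof.
rewrite /prob esum_mkcond.
rewrite (eq_esum (b := fun x => (push x)%:E * (if x \in B then 1 else 0))%E);
  last by move=> x _; case: ifP => _; rewrite ?mule1 ?mule0.
rewrite esum_push; last by move=> x; case: ifP.
rewrite (eq_bigr (fun o => (if h o \in B then w o else 0)%:E)); last first.
  by move=> o _; case: ifP => _; rewrite ?mule1 ?mule0.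
by rewrite sumEFin.
Qed.

Lemma is_distr_push : \sum_o w o = 1 -> is_distr push.
Proof.
move=> w1; split; first exact: push_ge0.
rewrite (eq_esum (b := fun x => (push x)%:E * 1)%E); last first.
  by move=> x _; rewrite mule1.
rewrite esum_push// (eq_bigr (fun o => (w o)%:E)) ?sumEFin ?w1//.
by move=> o _; rewrite mule1.
Qed.

End Pushforward.

Section Dirac.
Variables (R : realType) (T : choiceType).

Definition dirac (a x : T) : R := (x == a)%:R.

Lemma dirac_push a : dirac a = push (fun _ : unit => 1) (fun=> a).
Proof.
apply/funext => x; rewrite /push (big_pred1 tt) => [|[]//].
by rewrite /dirac; case: eqP.
Qed.

Lemma is_distr_dirac a : is_distr (dirac a).
Proof.
rewrite dirac_push; apply: is_distr_push => //.
by rewrite (big_pred1 tt) => [|[]].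
Qed.

Lemma esum_dirac a (G : T -> \bar R) : (forall x, 0 <= G x)%E ->
  (\esum_(x in [set: T]) (dirac a x)%:E * G x = G a)%E.
Proof.
move=> G0; rewrite dirac_push esum_push// (big_pred1 tt) ?mul1e//.
Qed.

End Dirac.

(** * Probabilities of events, total variation and sample expectations *)

Section Distributions.
Variables (R : realType).

Section Prob.
Variables (T : choiceType) (p : T -> R).
Hypothesis p_distr : is_distr p.

Lemma prob_fin B : (\esum_(x in B) (p x)%:E)%E \is a fin_num.
Proof.
case: p_distr => p0 p1; rewrite ge0_fin_numE; last first.
  by apply: esum_ge0 => x _; rewrite lee_fin.
apply: (@le_lt_trans _ _ 1%E); last by rewrite ltry.
rewrite -p1 (esum_mkcond B); apply: le_esum => x _.
by case: ifP; rewrite ?lee_fin.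
Qed.

Lemma prob_ge0 B : 0 <= prob p B.
Proof. by apply/fine_ge0/esum_ge0 => x _; rewrite lee_fin; case: p_distr. Qed.

Lemma prob_setC B : prob p B + prob p (~` B) = 1.
Proof.
rewrite /prob -fineD ?prob_fin//.
have := esumID B setT (fun x => (p x)%:E).
rewrite !setTI => <-; first by case: p_distr => _ ->.
by move=> x _; rewrite lee_fin; case: p_distr.
Qed.

Lemma prob_le1 B : prob p B <= 1.
Proof. by rewrite -(prob_setC B) lerDl prob_ge0. Qed.

Lemma le_prob1 (B : set T) x : B x -> p x <= prob p B.
Proof.
case: p_distr => p0 _ Bx; rewrite -lee_fin /prob fineK ?prob_fin//.
rewrite -(@esum_set1 _ _ x (fun x => (p x)%:E)) ?lee_fin// esum_mkcond.
rewrite (esum_mkcond B); apply: le_esum => y _.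
rewrite in_set1; case: eqP => [->|_]; first by rewrite mem_set.
by case: ifP; rewrite ?lee_fin.
Qed.

End Prob.

Lemma prob_dirac (T : choiceType) (a : T) (B : set T) :
  prob (dirac R a) B = (a \in B)%:R.
Proof.
rewrite dirac_push prob_push// (big_pred1 tt) => [|[]//].
by case: ifP.
Qed.

Lemma dTV_ge (p q : X -> R) B : is_distr p -> is_distr q ->
  `|prob p B - prob q B| <= dTV p q.
Proof.
move=> pd qd; apply: ub_le_sup; last by exists B.
exists 1 => _ [A _ <-].
have := prob_le1 pd A; have := prob_le1 qd A.
have := prob_ge0 pd A; have := prob_ge0 qd A.
by rewrite ler_norml => *; apply/andP; split; lra.
Qed.

Lemma dTV_le (p q : X -> R) r :
  (forall B, `|prob p B - prob q B| <= r) -> dTV p q <= r.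
Proof.
move=> H; apply: ge_sup; last by move=> _ [A _ <-].
by exists `|prob p set0 - prob q set0|; exists set0.
Qed.

(** An event containing [a] has [p]-probability at least [1 - r]; for any other event the complement
    does. *)
Lemma dTV_dirac (p : X -> R) a r : is_distr p -> 1 - r <= p a ->
  dTV (dirac R a) p <= r.
Proof.
move=> pd ra; apply: dTV_le => B; rewrite prob_dirac.
have p0 := prob_ge0 pd B; have p1 := prob_le1 pd B.
case: (boolP (a \in B)) => aB /=.
  have := le_prob1 pd (set_mem aB); rewrite ger0_norm; lra.
have : (~` B) a by move=> /mem_set; rewrite (negbTE aB).
move=> /(le_prob1 pd); have := prob_setC pd B.
rewrite ler0_norm; lra.
Qed.

(** The law of the sample is itself a pushforward, of the product weight on outcome functions,
    because a product of sums expands into a sum over functions. *)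
Lemma sample_expect_push (O : finType) (w : O -> R) (h : O -> X) m
    (F : mset -> \bar R) : (forall o, 0 <= w o) -> (forall S, 0 <= F S)%E ->
  sample_expect (push w h) m F =
  (\sum_(o : {ffun 'I_m -> O})
     (\prod_i w (o i))%:E * F (mset_of_seq (map h (codom o))))%E.
Proof.
move=> w0 F0.
pose W (o : {ffun 'I_m -> O}) := \prod_i w (o i).
pose H (o : {ffun 'I_m -> O}) := [tuple h (o i) | i < m].
transitivity (\sum_o (W o)%:E * F (mset_of_seq (H o)))%E; last first.
  apply: eq_bigr => o _; congr (_ * F (mset_of_seq _))%E.
  by rewrite /H /= /codom /image_mem -map_comp.
rewrite -(@esum_push _ _ _ W H _ (fun t => F (mset_of_seq t)))//; last first.
  by move=> o; apply: prodr_ge0.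
apply: eq_esum => t _; congr (_%:E * _)%E.
rewrite /push bigA_distr_bigA; apply: eq_bigr => o _.
case: eqP => [->|tH].
  by apply: eq_bigr => i _; rewrite tnth_mktuple eqxx.
(* A tuple other than the image of [o] disagrees at some coordinate, which contributes a zero
   factor. *)
have [i ti] : exists i, tnth t i != h (o i).
  apply/existsP; apply: contra_notT tH; rewrite negb_exists => /forallP E.
  by apply: eq_from_tnth => i; rewrite tnth_mktuple; apply/eqP/negPn/E.
by rewrite (bigD1 i)//= (negbTE ti) mul0r.
Qed.

End Distributions.

(** * The class and its hint learner *)

(** The components are the scale [n], the bound [N] and the bit string [s]. The length of [s] is
    unconstrained, as [nth false] pads it; the type is countable, so an index fits into one
    coordinate of a hint. *)
Definition index := (nat * nat * seq bool)%type.

(* A draw is the origin [inl false], the hint [inl true] or a data point. *)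
Definition draw (N : nat) := (bool + 'I_N.+1)%type.

(** The second coordinate 3 marks hints: it is 0 at the origin and 1 or 2 at data points. *)
Definition hint (i : index) : X := (choice.pickle i, 3)%N.

(* The data set [B_i] of the paper is the graph of the bit string [i.2]. *)
Definition place (i : index) (o : draw i.1.2) : X :=
  match o with
  | inl false => (0, 0)%N
  | inl true => hint i
  | inr x => (val x, (nth false i.2 x).+1)
  end.
Arguments place : clear implicits.

Definition hint_of (x : X) : option index :=
  if x.2 == 3%N then choice.unpickle x.1 else None.

Lemma hint_of_hint i : hint_of (hint i) = Some i.
Proof. by rewrite /hint_of /= choice.pickleK. Qed.

Lemma hint_of_place i o :
  hint_of (place i o) = if o == inl true then Some i else None.
Proof.
case: o => [[]|x] //=; first by rewrite hint_of_hint.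
by rewrite /hint_of /=; case: nth.
Qed.

Definition sample_of i m (o : {ffun 'I_m -> draw i.1.2}) : mset :=
  mset_of_seq (map (place i) (codom o)).
Arguments sample_of i {m} o.

Definition flip N m (o : {ffun 'I_m -> draw N}) (s : N.+1.-tuple bool) :
    N.+1.-tuple bool :=
  [tuple tnth s x (+) (inr x \notin codom o) | x < N.+1].

(** The flipped positions depend on [o] only, so a second flip undoes the first. *)
Lemma flipK N m (o : {ffun 'I_m -> draw N}) : involutive (flip o).
Proof.
move=> s; apply: eq_from_tnth => x; rewrite !tnth_mktuple.
by rewrite -addbA addbb addbF.
Qed.

Lemma nth_flip N m (o : {ffun 'I_m -> draw N}) s (x : 'I_N.+1) :
  nth false (flip o s) x = nth false s x (+) (inr x \notin codom o).
Proof. by rewrite -!tnth_nth tnth_mktuple. Qed.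

Definition hints N m (o : {ffun 'I_m -> draw N}) : nat :=
  count_mem (inl true) (codom o).

Section Class.
Variables (R : realType) (a : nat -> R).
Hypothesis a01 : forall n, 0 < a n <= 1.

Definition rate n : R := a n / n.+2%:R.

Definition weight n N (o : draw N) : R :=
  match o with
  | inl false => 1 - a n
  | inl true => rate n
  | inr _ => (a n - rate n) / N.+1%:R
  end.
Arguments weight : clear implicits.

Definition distr_of (i : index) : X -> R := push (weight i.1.1 i.1.2) (place i).

Lemma rate_gt0 n : 0 < rate n.
Proof. by rewrite divr_gt0//; case/andP: (a01 n). Qed.

Lemma rate_le n : rate n <= a n / 2.
Proof.
rewrite ler_pM2l; last by case/andP: (a01 n).
by rewrite lef_pV2 ?posrE// ler_nat.
Qed.

Lemma weight_ge0 n N o : 0 <= weight n N o.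
Proof.
have /andP[a0 a1] := a01 n; have := rate_gt0 n; have := rate_le n.
case: o => [[]|x] /=; try lra.
by move=> *; apply: divr_ge0 => //; lra.
Qed.

Lemma big_draw N (F : draw N -> R) :
  \sum_o F o = F (inl true) + F (inl false) + \sum_x F (inr x).
Proof. by rewrite big_sumType big_bool. Qed.

Lemma weight_sum n N : \sum_o weight n N o = 1.
Proof.
rewrite big_draw /= sumr_const card_ord -[X in _ + X]mulr_natr divfK ?pnatr_eq0//; lra.
Qed.

Lemma weight_no_hint n N :
  \sum_o weight n N o * (o != inl true)%:R = 1 - rate n.
Proof.
have := weight_sum n N; rewrite !big_draw /= mulr0 mulr1.
under [X in _ -> _ + X = _]eq_bigr do rewrite mulr1.
lra.
Qed.

Lemma is_distr_of i : is_distr (distr_of i).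
Proof.
by apply: is_distr_push; [exact: weight_ge0|exact: weight_sum].
Qed.

Lemma distr_of_origin i : 1 - a i.1.1 <= distr_of i (0, 0)%N.
Proof.
rewrite /distr_of /push (bigD1 (inl false))//= lerDl.
by apply: sumr_ge0 => o _; case: ifP => _ //; exact: weight_ge0.
Qed.

Definition prodw n N m (o : {ffun 'I_m -> draw N}) : R := \prod_k weight n N (o k).

Lemma prodw_ge0 n N m (o : {ffun 'I_m -> draw N}) : 0 <= prodw n o.
Proof. by apply: prodr_ge0 => k _; exact: weight_ge0. Qed.

Lemma prodw_sum n N m : \sum_(o : {ffun 'I_m -> draw N}) prodw n o = 1.
Proof.
rewrite -(bigA_distr_bigA (fun=> weight n N)) (eq_bigr (fun=> 1)) ?big1_eq// => k _.
exact: weight_sum.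
Qed.

Lemma sample_expect_distr_of i m (Q : mset -> Prop) :
  sample_expect (distr_of i) m (fun S => ind R (Q S)) =
  (\sum_(o : {ffun 'I_m -> draw i.1.2})
      prodw i.1.1 o * `[< Q (sample_of i o) >]%:R)%:E.
Proof.
have indE P : ind R P = (`[< P >]%:R)%:E by rewrite /ind; case: ifP.
rewrite /distr_of sample_expect_push; first last.
- by move=> S; rewrite indE lee_fin.
- exact: weight_ge0.
rewrite -sumEFin; apply: eq_bigr => o _.
by rewrite EFinM indE.
Qed.

Definition hint_learner : learner R := fun S =>
  if pmap hint_of (multiset.enum_mset S) is i :: _ then distr_of i
  else dirac R (0, 0)%N.

Lemma is_learner_hint : is_learner hint_learner.
Proof.
move=> S; rewrite /hint_learner; case: pmap => [|i _].
  exact: is_distr_dirac.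
exact: is_distr_of.
Qed.

(** All hints in a sample name the same index, so it does not matter which one is read first. The
    enumeration of a multiset is known only up to permutation, hence the comparison of members. *)
Lemma hint_learner_sample i m (o : {ffun 'I_m -> draw i.1.2}) :
  hint_learner (sample_of i o) =
  if inl true \in codom o then distr_of i else dirac R (0, 0)%N.
Proof.
rewrite /hint_learner /sample_of /mset_of_seq.
set s := map _ _; have sP := multiset.perm_eq_seq_mset s.
have : pmap hint_of (multiset.enum_mset (multiset.seq_mset s)) =i
       if inl true \in codom o then [:: i] else [::].
  move=> j; rewrite mem_pmap (perm_mem (perm_map hint_of sP)) -map_comp.
  apply/mapP/idP => [[d dS]|].
    rewrite /= hint_of_place; case: eqP => // dE [->].
    by rewrite -dE dS inE.
  case: ifP => // oo; rewrite inE => /eqP ->; exists (inl true) => //=.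
  by rewrite hint_of_hint.
case: ifP => _; case: pmap => [|j l] // H.
- by have := H i; rewrite !inE eqxx.
- by have := H j; rewrite !inE eqxx /= => /esym/eqP ->.
- by have := H j; rewrite !inE eqxx.
Qed.

Definition class : set (X -> R) := [set distr_of i | i in [set: index]].

Lemma hint_learner_pac (g : R -> R) :
  (forall n x, (a n)^-1 <= x -> n.+2%:R <= g x / x) ->
  pac_learnable_with class (fun eps delta => ln (1 / delta) * g (1 / eps)).
Proof.
move=> ga; exists hint_learner; split; first exact: is_learner_hint.
move=> _ [i _ <-] eps delta /andP[eps0 eps1] /andP[d0 d1] m.
rewrite !div1r => mge; rewrite sample_expect_distr_of lee_fin.
have dTVpp : dTV (distr_of i) (distr_of i) <= eps.
  by apply: dTV_le => B; rewrite subrr normr0 ltW.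
(* If [a n <= eps], both possible answers of the learner are within [eps], and it never fails. *)
case: (lerP (a i.1.1) eps) => aeps.
  rewrite (eq_bigr (fun o => prodw i.1.1 o)) ?prodw_sum; first by lra.
  move=> o _; case: asboolP => H; rewrite ?mulr1//; case: H.
  rewrite hint_learner_sample; case: ifP => _ //.
  apply: dTV_dirac; first exact: is_distr_of.
  by have := distr_of_origin i; lra.
set n := i.1.1 in aeps *; set N := i.1.2.
(* The probability that no hint is drawn factors over the independent draws. *)
have E : \sum_(o : {ffun 'I_m -> draw N})
    \prod_k (weight n N (o k) * (o k != inl true)%:R) = (1 - rate n) ^+ m.
  rewrite -(bigA_distr_bigA (fun _ d => weight n N d * (d != inl true)%:R)).
  rewrite (eq_bigr (fun=> 1 - rate n)) ?prodr_const ?card_ord//.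
  by move=> k _; exact: weight_no_hint.
apply: (@le_trans _ _ (1 - (1 - rate n) ^+ m)).
  have /andP[a0 _] := a01 n.
  rewrite lerD2l lerN2.
  apply: (@le_trans _ _ (expR (- rate n) ^+ m)).
    rewrite lerXn2r ?nnegrE ?expR_ge0//; last exact: expR_ge1Dx.
    by have /andP[_ ?] := a01 n; have := rate_le n; lra.
  rewrite -expRM_natl -[leRHS]lnK ?posrE// ler_expR.
  have l0 : 0 < - ln delta by rewrite oppr_gt0 ln_lt0// d0 d1.
  move: mge; rewrite lnV ?posrE// => mge.
  (* As [eps < a n], one has [(n + 2) / a n <= (n + 2) / eps <= g (1 / eps)]. *)
  have gb : (rate n)^-1 <= g eps^-1.
    have ea : (a n)^-1 <= eps^-1 by rewrite lef_pV2 ?posrE// ltW.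
    have e0 : 0 < eps^-1 by rewrite invr_gt0.
    have := ga n _ ea; rewrite ler_pdivlMr// => H.
    rewrite /rate invfM invrK mulrC; apply: le_trans H.
    by rewrite ler_pM2l.
  have : - ln delta * (rate n)^-1 <= m%:R.
    by apply: le_trans mge; rewrite ler_pM2l.
  rewrite ler_pdivrMr ?rate_gt0// mulrN; lra.
(* The comparison is made outcome by outcome: the learner can fail only if no hint was drawn, and
   then the product of indicators is 1. *)
rewrite -E -[X in X - _ <= _](prodw_sum n N m) -sumrB; apply: ler_sum => o _.
rewrite big_split /= -/(prodw n o) -[X in X - _]mulr1 -mulrBr.
apply: ler_wpM2l; first exact: prodw_ge0.
case: asboolP => H; first by rewrite gerBl; apply: prodr_ge0.
suff -> : \prod_k ((o k != inl true)%:R : R) = 1 by rewrite subrr.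
rewrite big1// => k _; apply/eqP; rewrite pnatr_eq1 eqb1.
apply: contra_notN H => /eqP ok; rewrite hint_learner_sample.
by rewrite -ok codom_f.
Qed.

(** * The averaging lower bound *)

(** Linearity of expectation: each of the [m] draws is a hint with probability [rate n]. *)
Lemma expect_hints n N m :
  \sum_(o : {ffun 'I_m -> draw N}) prodw n o * (hints o)%:R = m%:R * rate n.
Proof.
have hintsE (o : {ffun 'I_m -> draw N}) :
    (hints o)%:R = \sum_k (o k == inl true)%:R :> R.
  rewrite -natr_sum; congr _%:R.
  by rewrite /hints -sum1_count /codom /image_mem big_map big_mkcond big_enum.
under eq_bigr do rewrite hintsE mulr_sumr.
rewrite exchange_big /= -[m in RHS]card_ord mulr_natl -sumr_const.
apply: eq_bigr => k _.
(* The hint indicator sits at coordinate [k] alone; every other factor sums to 1. *)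
pose F (k' : 'I_m) d := weight n N d * (if k' == k then (d == inl true)%:R else 1).
transitivity (\sum_(o : {ffun 'I_m -> draw N}) \prod_k' F k' (o k')).
  by apply: eq_bigr => o _; rewrite big_split /= -big_mkcond big_pred1_eq.
rewrite -bigA_distr_bigA (bigD1 k)//= [X in _ * X]big1 ?mulr1.
  rewrite big_draw /F eqxx /= mulr1n mulr0n mulr0 mulr1 big1 ?addr0// => x _.
  by rewrite mulr0.
move=> k' /negbTE k'k; rewrite -(weight_sum n N); apply: eq_bigr => d _.
by rewrite /F k'k mulr1.
Qed.

(** The event [B] of unobserved data points under [s] separates the two distributions: flipping
    moves each of these points away, so [B] becomes null, while under [s] at least [N + 1 - m]
    positions contribute their full weight. *)
Lemma dTV_flip_gt n N m (o : {ffun 'I_m -> draw N}) (s : N.+1.-tuple bool)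
    (q : X -> R) (r : R) :
  is_distr q ->
  2 * r < (a n - rate n) / N.+1%:R * (N.+1%:R - m%:R) ->
  dTV q (distr_of (n, N, val s)) <= r ->
  dTV q (distr_of (n, N, val (flip o s))) <= r -> False.
Proof.
move=> qd rlt d1 d2.
pose B : set X := [set y | exists2 x : 'I_N.+1, inr x \notin codom o &
  y = (val x, (nth false s x).+1)].
have := le_trans (dTV_ge B qd (is_distr_of (n, N, val s))) d1.
have := le_trans (dTV_ge B qd (is_distr_of (n, N, val (flip o s)))) d2.
have c0 : 0 <= (a n - rate n) / N.+1%:R.
  by have := weight_ge0 n (inr (ord0 : 'I_N.+1)).
have -> : prob (distr_of (n, N, val (flip o s))) B = 0.
  rewrite /distr_of prob_push; last exact: weight_ge0.
  rewrite big1// => d _; case: ifP => // /set_mem [x xo].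
  case: d => [[]|y] // []; first by move=> _; case: nth.
  by move=> /ord_inj -> /eqP; rewrite nth_flip xo addbT; case: nth.
have : (a n - rate n) / N.+1%:R * (N.+1%:R - m%:R) <=
       prob (distr_of (n, N, val s)) B.
  rewrite /distr_of prob_push; last exact: weight_ge0.
  rewrite big_draw /= -[leLHS]add0r lerD//.
    by rewrite addr_ge0//; case: ifP => _ //; 
      [exact: (weight_ge0 n (inl true : draw N))
      |exact: (weight_ge0 n (inl false : draw N))].
  apply: (@le_trans _ _ (\sum_(x : 'I_N.+1 | inr x \notin codom o)
      (a n - rate n) / N.+1%:R)); last first.
    rewrite big_mkcond; apply: ler_sum => x _; case: ifP => xo.
      by rewrite mem_set//; exists x.
    by case: ifP.
  rewrite sumr_const -[leRHS]mulr_natr ler_wpM2l//.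
  rewrite lerBlDr -natrD ler_nat.
  (* The observed positions inject into the [m] entries of [codom o], so at most [m] of them are
     lost. *)
  have := cardC [pred x : 'I_N.+1 | inr x \in codom o].
  rewrite card_ord => cardE; rewrite -[leqLHS]cardE addnC leq_add2l.
  rewrite -(fintype.card_image (@inr_inj bool 'I_N.+1)).
  have so : size (codom o) = m by rewrite size_codom card_ord.
  rewrite -[leqRHS]so; apply: leq_trans (card_size _); apply: subset_leq_card.
  by apply/fintype.subsetP => d /fintype.imageP [x xo ->].
move: (prob _ B) (prob q B) => u v.
rewrite !ler_norml => /(lt_le_trans rlt) h1 /andP[? ?] /andP[? ?]. lra.
Qed.

(* For a fixed outcome [o] of the draws, [flip o] pairs up the bit strings, and
   an adversary that makes both members of a pair look alike forces the learner
   to fail on one of them. *)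
Lemma no_learner n N m (W : mset -> mset) (bd : nat) (A : learner R)
    (r : R) :
  is_learner A ->
  2 * r < (a n - rate n) / N.+1%:R * (N.+1%:R - m%:R) ->
  2 * m%:R * rate n <= bd.+1%:R ->
  (forall (s : N.+1.-tuple bool) (o : {ffun 'I_m -> draw N}), (hints o <= bd)%N ->
     W (sample_of (n, N, val s) o) = W (sample_of (n, N, val (flip o s)) o)) ->
  exists i, i.1.1 = n /\
    (sample_expect (distr_of i) m
      (fun S => ind R (dTV (A (W S)) (distr_of i) <= r)%R) < (7 / 8)%:E)%E.
Proof.
move=> Ad rlt bdm WE; apply: contrapT => H.
have {}H (s : N.+1.-tuple bool) : 7 / 8 <= \sum_(o : {ffun 'I_m -> draw N})
  prodw n o * `[< dTV (A (W (sample_of (n, N, val s) o)))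
                    (distr_of (n, N, val s)) <= r >]%:R.
  rewrite leNgt; apply/negP => lt; apply: H.
  by exists (n, N, val s); split=> //; rewrite sample_expect_distr_of lte_fin.
pose ok (s : N.+1.-tuple bool) (o : {ffun 'I_m -> draw N}) : R :=
  `[< dTV (A (W (sample_of (n, N, val s) o)))
                    (distr_of (n, N, val s)) <= r >]%:R.
pose K : R := #|{: N.+1.-tuple bool}|%:R.
have KE x : K * x = \sum_(s : N.+1.-tuple bool) x.
  by rewrite sumr_const /K mulr_natl.
have K0 : 0 < K by rewrite ltr0n card_tuple expn_gt0 card_bool.
clearbody K.
have ge : K * (7 / 8) <= \sum_s \sum_o prodw n o * ok s o.
  by rewrite KE; apply: ler_sum => s _; exact: H.
(* With at most [bd] hints, at most one string of each pair succeeds. Otherwise the fraction is at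
   least 1 and the trivial bound 2 suffices; this is Markov's inequality in pointwise form. *)
have pair (o : {ffun 'I_m -> draw N}) :
    2 * \sum_s ok s o <= K * (1 + (hints o)%:R / bd.+1%:R).
  rewrite mulr_natl mulr2n {2}(reindex_inj (inv_inj (flipK o))) /= -big_split /=.
  rewrite KE; apply: ler_sum => s _.
  case: (leqP (hints o) bd) => ho.
    apply: (@le_trans _ _ 1); last by rewrite lerDl divr_ge0.
    rewrite /ok -natrD lern1 -WE//.
    case: asboolP => d1; case: asboolP => d2 //.
    by case: (dTV_flip_gt (Ad _) rlt d1 d2).
  apply: (@le_trans _ _ (1 + 1)); first by rewrite lerD// /ok lern1 leq_b1.
  by rewrite lerD2l ler_pdivlMr ?ltr0n// mul1r ler_nat.
(* The expected fraction is at most 1/2, so the average success is at most [(1 + 1/2) / 2 = 3/4],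
   short of 7/8. *)
have le : \sum_s \sum_o prodw n o * ok s o <= K * (3 / 4).
  have bn0 : bd.+1%:R != 0 :> R by rewrite pnatr_eq0.
  rewrite exchange_big /=.
  apply: (@le_trans _ _ (\sum_(o : {ffun 'I_m -> draw N})
     prodw n o * (K * (1 + (hints o)%:R / bd.+1%:R) / 2))).
    apply: ler_sum => o _; rewrite -mulr_sumr ler_wpM2l ?prodw_ge0//.
    by rewrite ler_pdivlMr// mulrC; exact: pair.
  rewrite (eq_bigr (fun o => K / 2 * prodw n o +
      K / 2 / bd.+1%:R * (prodw n o * (hints o)%:R))); last first.
    by move=> o _; move: (bd.+1%:R) bn0 => c c0; field.
  rewrite big_split /= -!mulr_sumr prodw_sum expect_hints.
  have : m%:R * rate n / bd.+1%:R <= 1 / 2.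
    by rewrite ler_pdivrMr ?ltr0n//; lra.
  have -> : K / 2 / bd.+1%:R * (m%:R * rate n) =
            K * (m%:R * rate n / bd.+1%:R) / 2.
    by move: (bd.+1%:R) bn0 => c c0; field.
  rewrite -(ler_pM2l K0); move: (K * (m%:R * _ / _)) => u; lra.
by have := le_trans ge le; rewrite ler_pM2l//; lra.
Qed.

(** * Deterministic adversaries, their failure criterion and their budgets *)

Definition determ (W : mset -> mset) : adversary R := fun S => dirac R (W S).

Lemma robust_expect_lower i (W : mset -> mset) (A : learner R) m r :
  sample_expect (distr_of i) m (fun S =>
    \esum_(S' in [set: mset]) (determ W S S')%:E
      * ind R (dTV (A S') (distr_of i) <= r)%R)%E =
  sample_expect (distr_of i) m
    (fun S => ind R (dTV (A (W S)) (distr_of i) <= r)%R).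
Proof.
congr (sample_expect _ _ _); apply/funext => S; rewrite /determ esum_dirac// => S'.
by rewrite /ind; case: ifP.
Qed.

Lemma not_robust_learnable n alpha (W : mset -> mset)
    (bud : adversary R -> R -> Prop) :
  0 <= alpha -> 32 * alpha <= n.+2%:R -> bud (determ W) (2 * rate n) ->
  (forall N m (s : N.+1.-tuple bool) (o : {ffun 'I_m -> draw N}),
     (hints o <= Num.truncn (2 * rate n * m%:R))%N ->
     W (sample_of (n, N, val s) o) = W (sample_of (n, N, val (flip o s)) o)) ->
  ~ robust_learnable class [set determ W] bud alpha.
Proof.
move=> alpha0 nalpha budW WE [A [mf [Ad learn]]].
have /andP[a0 a1] := a01 n; have r0 := rate_gt0 n; have ra := rate_le n.
(* These choices give [r <= a n / 16 + a n / 32], hence [2 * r < a n / 4]. The value [delta = 1/8]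
   matches the bound 7/8 of [no_learner]. *)
pose eps : R := a n / 32; pose m := mf eps (1 / 8).
have [|||i [iE]] := @no_learner n m.*2 m W (Num.truncn (2 * rate n * m%:R)) A
    (alpha * (2 * rate n) + eps) Ad.
(* With [N = 2m], the unobserved fraction is at least [(m + 1) / (2m + 1)], above one half. *)
- have Nm : 1 / 2 <= (m.*2.+1%:R - m%:R) / m.*2.+1%:R :> R.
    rewrite ler_pdivlMr ?ltr0n// -addnn -![(m + m).+1%:R]natr1 natrD.
    by have : 0 <= m%:R :> R by []; lra.
  have ar : 32 * (alpha * rate n) <= a n.
    rewrite mulrA [32 * alpha * _]mulrA ler_pdivrMr ?ltr0n//.
    by rewrite [leRHS]mulrC ler_pM2r.
  rewrite mulrAC -mulrA.
  apply: (@lt_le_trans _ _ ((a n - rate n) * (1 / 2))).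
    by rewrite /eps mulrCA; lra.
  by rewrite ler_pM2l//; lra.
- by rewrite [2 * _ * _]mulrAC ltW// truncnS_gt.
- by move=> s o; exact: WE.
rewrite ltNge => /negP; apply; rewrite -robust_expect_lower.
have := learn (distr_of i) _ (determ W) erefl _ budW eps (1 / 8) _ _ m (leqnn _).
have -> : 1 - 1 / 8 = 7 / 8 :> R by lra.
apply.
- by exists i.
- by rewrite /eps; lra.
- by lra.
Qed.

Lemma outputs_determ (W : mset -> mset) S T : outputs (determ W) S T <-> T = W S.
Proof. by rewrite /outputs /determ /dirac ltr0n lt0b; split=> /eqP. Qed.

Lemma fixed_size_determ (W : mset -> mset) (f : nat -> nat) :
  (forall S, msize (W S) = f (msize S)) -> fixed_size (determ W).
Proof.
by move=> Wf S1 S2 T1 T2 ST /outputs_determ-> /outputs_determ->; rewrite !Wf ST.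
Qed.

Lemma msize_seq (s : seq X) : msize (mset_of_seq s) = size s.
Proof. exact/perm_size/multiset.perm_eq_seq_mset. Qed.

Lemma msize_exists m : exists S, msize S = m.
Proof. by exists (mset_of_seq (nseq m (0, 0)%N)); rewrite msize_seq size_nseq. Qed.

Section Budget.
Variables (eta : R) (W : mset -> mset).
Hypothesis eta01 : 0 <= eta <= 1.

Lemma truncn_budget (m : nat) : let b := (Num.truncn (eta * m%:R))%:R in
  eta * m%:R - 1 < b /\ b <= eta * m%:R.
Proof.
have /andP[e0 _] := eta01.
have /andP[le lt] := truncn_itv (mulr_ge0 e0 (ler0n _ m)).
by split=> //; rewrite ltrBlDr natr1.
Qed.

(** This keeps the natural-number subtraction in the subtractive budget exact. *)
Lemma truncn_budget_le m : (Num.truncn (eta * m%:R) <= m)%N.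
Proof.
have /andP[_ e1] := eta01; have [_ le] := truncn_budget m.
by rewrite -(ler_nat R) (le_trans le)// ler_piMl.
Qed.

Lemma has_budget_add_determ :
  (forall S, msize (W S) = msize S + Num.truncn (eta * (msize S)%:R))%N ->
  has_budget_add (determ W) eta.
Proof.
move=> Wsz; split.
  exact: (@fixed_size_determ _ (fun m => m + Num.truncn (eta * m%:R))%N Wsz).
move=> m m0; have [lt le] := truncn_budget m.
have -> : m%:R * budget_add_m (determ W) m = (Num.truncn (eta * m%:R))%:R.
  rewrite /budget_add_m.
  (* The output size depends on the input size only, so the supremum runs over a singleton. *)
  rewrite (_ : [set r | _] = [set (Num.truncn (eta * m%:R))%:R / m%:R]).
    by rewrite sup1 mulrC divfK// pnatr_eq0 -lt0n.
  apply/seteqP; split=> r /=.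
    move=> [S [T [Sm [/outputs_determ -> ->]]]].
    by rewrite Wsz Sm natrD addrAC subrr add0r.
  move=> ->; have [S Sm] := msize_exists m; exists S, (W S).
  by rewrite outputs_determ Wsz Sm natrD addrAC subrr add0r.
by [].
Qed.

Lemma has_budget_sub_determ :
  (forall S, msize (W S) = msize S - Num.truncn (eta * (msize S)%:R))%N ->
  has_budget_sub (determ W) eta.
Proof.
move=> Wsz; split.
  exact: (@fixed_size_determ _ (fun m => m - Num.truncn (eta * m%:R))%N Wsz).
move=> m m0; have [lt le] := truncn_budget m.
have -> : m%:R * budget_sub_m (determ W) m = (Num.truncn (eta * m%:R))%:R.
  rewrite /budget_sub_m.
  rewrite (_ : [set r | _] = [set (Num.truncn (eta * m%:R))%:R / m%:R]).
    by rewrite sup1 mulrC divfK// pnatr_eq0 -lt0n.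
  apply/seteqP; split=> r /=.
    move=> [S [T [Sm [/outputs_determ -> ->]]]].
    by rewrite Wsz Sm natrB ?truncn_budget_le// subKr.
  move=> ->; have [S Sm] := msize_exists m; exists S, (W S).
  by rewrite outputs_determ Wsz Sm natrB ?truncn_budget_le// subKr.
by [].
Qed.

End Budget.

Lemma additive_advs_determ eta W : 0 <= eta <= 1 ->
  (forall S, msub S (W S)) ->
  (forall S, msize (W S) = msize S + Num.truncn (eta * (msize S)%:R))%N ->
  additive_advs (determ W) /\ has_budget_add (determ W) eta.
Proof.
move=> eta01 Wsub Wsz.
have bud := has_budget_add_determ eta01 Wsz; split=> //; split.
  by move=> S; exact: is_distr_dirac.
by split; [move=> S T /outputs_determ ->|exists eta].
Qed.

Lemma subtractive_advs_determ eta W : 0 <= eta <= 1 ->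
  (forall S, msub (W S) S) ->
  (forall S, msize (W S) = msize S - Num.truncn (eta * (msize S)%:R))%N ->
  subtractive_advs (determ W) /\ has_budget_sub (determ W) eta.
Proof.
move=> eta01 Wsub Wsz.
have bud := has_budget_sub_determ eta01 Wsz; split=> //; split.
  by move=> S; exact: is_distr_dirac.
by split; [move=> S T /outputs_determ ->|exists eta].
Qed.

End Class.

(** * The two adversaries *)

Section Adversaries.

Definition is_hint (y : X) : bool := isSome (hint_of y).

(** Second coordinates 1 and 2 encode the bits false and true at position [x]. *)
Definition observed (S : mset) (x : nat) : bool :=
  ((x, 1)%N \in multiset.enum_mset S) || ((x, 2)%N \in multiset.enum_mset S).

(** The adversary does not see the outcome [o], so the flipped string is recomputed from the sample
    alone. *)
Definition flip_hint (S : mset) (y : X) : X :=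
  if hint_of y is Some i then
    hint (i.1, mkseq (fun x => nth false i.2 x (+) ~~ observed S x) i.1.2.+1)
  else y.

Definition rest i m (o : {ffun 'I_m -> draw i.1.2}) : seq X :=
  [seq place i d | d <- codom o & d != inl true].
Arguments rest i {m} o.

Lemma perm_sample_of i m (o : {ffun 'I_m -> draw i.1.2}) :
  perm_eq (multiset.enum_mset (sample_of i o))
          (nseq (hints o) (hint i) ++ rest i o).
Proof.
apply: (perm_trans (multiset.perm_eq_seq_mset _)).
have : perm_eq (codom o) ([seq d <- codom o | d == inl true] ++
                          [seq d <- codom o | d != inl true]).
  by rewrite perm_sym perm_filterC.
move=> /(perm_map (place i)) /perm_trans; apply.
rewrite map_cat -/(rest i o).
have /all_pred1P -> : all (pred1 (inl true)) [seq d <- codom o | d == inl true].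
  exact: filter_all.
by rewrite size_filter map_nseq perm_refl.
Qed.

Lemma msize_sample_of i m (o : {ffun 'I_m -> draw i.1.2}) :
  msize (sample_of i o) = m.
Proof. by rewrite /sample_of msize_seq size_map size_codom card_ord. Qed.

Lemma filter_hint_rest i m (o : {ffun 'I_m -> draw i.1.2}) :
  seq.filter is_hint (rest i o) = [::].
Proof.
apply/eqP; rewrite -(negbK (_ == _)) -has_filter; apply/hasPn => y /mapP[d].
by rewrite mem_filter => /andP[/negbTE dh _] ->; rewrite /is_hint hint_of_place dh.
Qed.

Lemma is_hint_hint i : is_hint (hint i).
Proof. by rewrite /is_hint hint_of_hint. Qed.

Lemma filter_hint_sample i m (o : {ffun 'I_m -> draw i.1.2}) :
  seq.filter is_hint (multiset.enum_mset (sample_of i o)) =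
  nseq (hints o) (hint i).
Proof.
have := perm_filter is_hint (perm_sample_of o).
rewrite filter_cat filter_hint_rest cats0 filter_nseq is_hint_hint mul1n => p.
have := perm_all (pred1 (hint i)) p; rewrite (all_pred1_nseq (hint i)).
move=> /all_pred1P ->; congr nseq.
by rewrite (perm_size p) size_nseq.
Qed.

Lemma perm_filter_rest_sample i m (o : {ffun 'I_m -> draw i.1.2}) :
  perm_eq (seq.filter (predC is_hint) (multiset.enum_mset (sample_of i o)))
          (rest i o).
Proof.
have := perm_filter (predC is_hint) (perm_sample_of o).
rewrite filter_cat filter_nseq /= is_hint_hint mul0n /=.
suff /all_filterP -> : all (predC is_hint) (rest i o) by [].
by rewrite all_predC has_filter filter_hint_rest.
Qed.

(** Flipping leaves every observed bit alone, so the drawn data points cannot tell the two strings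
    apart. *)
Lemma rest_flip n N m (s : N.+1.-tuple bool) (o : {ffun 'I_m -> draw N}) :
  rest (n, N, val (flip o s)) o = rest (n, N, val s) o.
Proof.
apply/eq_in_map => -[[]|x]; rewrite mem_filter // => /andP[_ xo].
by congr (_, (nat_of_bool _).+1); rewrite [LHS]nth_flip xo addbF.
Qed.

Lemma observed_sample_of n N m (s : N.+1.-tuple bool)
    (o : {ffun 'I_m -> draw N}) (x : 'I_N.+1) :
  observed (sample_of (n, N, val s) o) x = (inr x \in codom o).
Proof.
rewrite /observed !(perm_mem (multiset.perm_eq_seq_mset _)).
apply/orP/idP => [H|xo].
  have {H} [b] : exists b : bool,
      (val x, b.+1) \in map (place (n, N, val s)) (codom o).
    by case: H => H; [exists false|exists true].
  move=> /mapP[[[]|y] yo] // []; first by case: (b).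
  by move=> /ord_inj ->.
have := map_f (place (n, N, val s)) xo => /=.
by case: (nth false (val s) x); [right|left].
Qed.

Lemma flip_hint_sample n N m (s : N.+1.-tuple bool) (o : {ffun 'I_m -> draw N}) :
  flip_hint (sample_of (n, N, val s) o) (hint (n, N, val s)) =
  hint (n, N, val (flip o s)).
Proof.
rewrite /flip_hint hint_of_hint; congr (hint (_, _)).
apply: (@eq_from_nth _ false); rewrite size_mkseq ?size_tuple// => x xN.
rewrite nth_mkseq// -[x]/(val (Ordinal xN)) observed_sample_of.
exact/esym/(nth_flip o s (Ordinal xN)).
Qed.

Variables (R : realType) (eta : R).

Definition quota (S : mset) : nat := Num.truncn (eta * (msize S)%:R).

(** Copies of the origin pad the addition to exactly the quota, also when there are too many hints
    to match, so that the output size is fixed by the input size. *)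
Definition add_decoys (S : mset) : mset :=
  let h := seq.filter is_hint (multiset.enum_mset S) in
  mset_of_seq (multiset.enum_mset S ++
    (if (size h <= quota S)%N then
       map (flip_hint S) h ++ nseq (quota S - size h) (0, 0)%N
     else nseq (quota S) (0, 0)%N)).

(* The non-hints pass through a multiset so that their enumeration, hence the
   part of it that is removed, does not depend on the hints. *)
Definition drop_hints (S : mset) : mset :=
  mset_of_seq (drop (quota S)
    (seq.filter is_hint (multiset.enum_mset S) ++
     multiset.enum_mset
       (mset_of_seq (seq.filter (predC is_hint) (multiset.enum_mset S))))).

Lemma msize_add_decoys S : msize (add_decoys S) = (msize S + quota S)%N.
Proof.
rewrite /add_decoys msize_seq size_cat; congr addn.
case: ifP => h; rewrite ?size_nseq// size_cat size_map size_nseq.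
by rewrite subnKC.
Qed.

Lemma msub_add_decoys S : msub S (add_decoys S).
Proof.
apply/multiset.msubsetP => x.
by rewrite multiset.mset_seqE count_cat multiset.count_mem_mset leq_addr.
Qed.

Lemma perm_drop_hints S :
  perm_eq (seq.filter is_hint (multiset.enum_mset S) ++
     multiset.enum_mset
       (mset_of_seq (seq.filter (predC is_hint) (multiset.enum_mset S))))
    (multiset.enum_mset S).
Proof.
rewrite perm_sym -(permPl (permEl (perm_filterC is_hint _))) perm_cat2l perm_sym.
exact: multiset.perm_eq_seq_mset.
Qed.

Lemma msize_drop_hints S : msize (drop_hints S) = (msize S - quota S)%N.
Proof. by rewrite /drop_hints msize_seq size_drop (perm_size (perm_drop_hints S)). Qed.

Lemma msub_drop_hints S : msub (drop_hints S) S.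
Proof.
apply/multiset.msubsetP => x.
rewrite multiset.mset_seqE -multiset.count_mem_mset.
rewrite -(permP (perm_drop_hints S)) -[X in (_ <= count _ X)%N](cat_take_drop (quota S)).
by rewrite [leqRHS]count_cat leq_addl.
Qed.

(** Hints come first in the list, so a quota covering them removes them all, and what is then cut
    from the common remainder is the same for both strings. *)
Lemma drop_hints_flip n N m (s : N.+1.-tuple bool) (o : {ffun 'I_m -> draw N}) :
  (hints o <= Num.truncn (eta * m%:R))%N ->
  drop_hints (sample_of (n, N, val s) o) =
  drop_hints (sample_of (n, N, val (flip o s)) o).
Proof.
move=> ho.
have restE s' : mset_of_seq (seq.filter (predC is_hint)
    (multiset.enum_mset (sample_of (n, N, val s') o))) =
    mset_of_seq (rest (n, N, val s') o).
  exact/multiset.eq_seq_msetP/perm_filter_rest_sample.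
rewrite /drop_hints !restE rest_flip !filter_hint_sample /quota !msize_sample_of.
by rewrite !drop_cat !size_nseq ltnNge ho.
Qed.

Lemma add_decoys_flip n N m (s : N.+1.-tuple bool) (o : {ffun 'I_m -> draw N}) :
  (hints o <= Num.truncn (eta * m%:R))%N ->
  add_decoys (sample_of (n, N, val s) o) =
  add_decoys (sample_of (n, N, val (flip o s)) o).
Proof.
move=> ho.
rewrite /add_decoys !filter_hint_sample /quota !msize_sample_of !size_nseq ho.
rewrite !map_nseq !flip_hint_sample flipK.
apply/multiset.eq_seq_msetP.
rewrite (permPl (perm_cat (perm_sample_of (i := (n, N, val s)) o) (perm_refl _))).
rewrite perm_sym.
rewrite (permPl (perm_cat (perm_sample_of (i := (n, N, val (flip o s))) o)
  (perm_refl _))) rest_flip.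
(* By [flipK] the decoys of either sample are the hints of the other, in equal number; counting only
   swaps the two blocks. *)
apply/permP => q; rewrite !count_cat.
by rewrite addnACA (addnC (count _ _)) addnACA.
Qed.

End Adversaries.

Theorem theorem4p1 (R : realType) (g : R -> R) :
  superlinear g ->
  exists C : set (X -> R),
    (forall p, C p -> is_distr p) /\
    (* (i) *)
    pac_learnable_with C (fun eps delta => ln (1 / delta) * g (1 / eps)) /\
    (* (ii) *)
    (forall alpha : R, 1 <= alpha -> ~ add_robust_learnable C alpha) /\
    (forall alpha : R, 1 <= alpha ->
       exists V, additive_advs V /\ universal_add_adversary C V alpha) /\
    (* (iii) *)
    (forall alpha : R, 1 <= alpha -> ~ sub_robust_learnable C alpha) /\
    (forall alpha : R, 1 <= alpha ->
       exists V, subtractive_advs V /\ universal_sub_adversary C V alpha).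
Proof.
move=> gsup.
have [x0 x0P] := choice (fun n => gsup n.+2%:R).
(* The inverse of [a n] is a threshold beyond which [g x / x] is at least [n + 2]; the maximum with
   1 ensures [0 < a n <= 1]. *)
pose a n : R := (Num.max 1 (x0 n))^-1.
have max1 n : 1 <= Num.max 1 (x0 n) by rewrite le_max lexx.
have a01 n : 0 < a n <= 1.
  have p0 : 0 < Num.max 1 (x0 n) by apply: lt_le_trans (max1 n).
  by rewrite /a invr_gt0 p0 invf_le1 ?max1.
have ga n x : (a n)^-1 <= x -> n.+2%:R <= g x / x.
  by rewrite /a invrK ge_max => /andP[_ /x0P].
have eta01 n : 0 <= 2 * rate a n <= 1.
  have /andP[a0 a1] := a01 n; have := rate_gt0 a01 n; have := rate_le a01 n.
  by move=> *; apply/andP; split; lra.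
have large (alpha : R) : exists n : nat, 32 * alpha <= n.+2%:R.
  exists (Num.truncn (32 * alpha)); rewrite ltW//.
  by apply: lt_le_trans (truncnS_gt _) _; rewrite ler_nat.
have add alpha : 1 <= alpha -> exists V,
    additive_advs V /\ universal_add_adversary (class a) V alpha.
  move=> alpha1; have [n nalpha] := large alpha.
  have [advV budV] := additive_advs_determ (eta01 n)
    (msub_add_decoys _) (msize_add_decoys _).
  exists (determ R (add_decoys (2 * rate a n))); split=> //.
  apply: (not_robust_learnable a01 _ nalpha budV); first exact: le_trans alpha1.
  by move=> N m s o; exact: add_decoys_flip.
have sub alpha : 1 <= alpha -> exists V,
    subtractive_advs V /\ universal_sub_adversary (class a) V alpha.
  move=> alpha1; have [n nalpha] := large alpha.
  have [advV budV] := subtractive_advs_determ (eta01 n)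
    (msub_drop_hints _) (msize_drop_hints _).
  exists (determ R (drop_hints (2 * rate a n))); split=> //.
  apply: (not_robust_learnable a01 _ nalpha budV); first exact: le_trans alpha1.
  by move=> N m s o; exact: drop_hints_flip.
exists (class a); split; first by move=> _ [i _ <-]; exact: is_distr_of.
split; first exact: hint_learner_pac.
split; last split=> //; last split=> //.
(* A learner good against all additive adversaries would in particular withstand the universal
   one. *)
- move=> alpha /add[V [advV univV]] [A [mf [Ad H]]]; apply: univV.
  by exists A, mf; split=> // p Cp _ ->; exact: H.
- move=> alpha /sub[V [advV univV]] [A [mf [Ad H]]]; apply: univV.
  by exists A, mf; split=> // p Cp _ ->; exact: H.
Qed.
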